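(* For every finite oriented graph $D$, $$\vec{\chi}_a(D)\leq L(D).$$
   Context: All digraphs are finite and nonempty, with no loops and no parallel arcs. An oriented graph is a digraph with no pair of opposite arcs. A digraph is acyclic if it has no directed cycle. For disjoint $X,Y\subseteq V(D)$, $D[X,Y]$ denotes the bipartite subdigraph of $D$ on $X\cup Y$ whose arcs are all arcs of $D$ with one end in $X$ and the other in $Y$. An acyclic $q$-dicolouring of an oriented graph $D$ is a partition of $V(D)$ into nonempty classes $C_1,\ldots,C_q$ such that every induced subdigraph $D[C_i]$ is acyclic and every $D[C_i,C_j]$ with $i\neq j$ is acyclic. The acyclic dichromatic number $\vec{\chi}_a(D)$ is the minimum $q$ for which an acyclic $q$-dicolouring exists. $L(D)$ is the maximum order (number of vertices) of a directed path in $D$, where a directed path is a sequence of distinct vertices $(v_1,\ldots,v_p)$ with $v_iv_{i+1}$ an arc for $1\le i<p$. *)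

(* Defs.v *)
From mathcomp Require Import all_boot.

Set Implicit Arguments.
Unset Strict Implicit.
Unset Printing Implicit Defensive.

Record digraph := Digraph {
  vertex :> finType;
  arc : rel vertex;
  arc_irreflexive : irreflexive arc;
  vertex_gt0 : 0 < #|vertex|
}.

Definition oriented (D : digraph) : Prop :=
  forall x y : D, arc x y -> ~~ arc y x.

Section Relations.

Variable T : finType.
Implicit Types (r : rel T) (X Y : {set T}) (s : seq T).

Definition dipath r s : bool := [&& 0 < size s, uniq s & sorted r s].

Definition dicycle r s : bool := [&& 1 < size s, uniq s & cycle r s].

(* Vertices of a dipath or dicycle are distinct, so it is enough to quantify
   over sequences of length at most #|T|; see [acyclicP] and
   [max_dipath_orderP]. *)
Definition acyclic r : bool := [forall s : {bseq #|T| of T}, ~~ dicycle r s].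

Definition max_dipath_order r : nat :=
  \max_(s : {bseq #|T| of T} | dipath r s) size s.

(* D[X] and D[X, Y] are represented by their arc relations on the whole vertex
   type: the vertices outside X (resp. outside X and Y) are isolated, hence on
   no directed cycle. *)
Definition induced r X : rel T := [rel x y | [&& x \in X, y \in X & r x y]].

Definition between r X Y : rel T :=
  [rel x y | ((x \in X) && (y \in Y) || (x \in Y) && (y \in X)) && r x y].

Lemma uniq_size_le s : uniq s -> size s <= #|T|.
Proof. by move/card_uniqP <-; apply: max_card. Qed.

Lemma acyclicP r : reflect (forall s, ~~ dicycle r s) (acyclic r).
Proof.
apply: (iffP forallP) => [acyc s | acyc s]; last exact: acyc.
apply/negP => cyc_s; have /and3P[_ us _] := cyc_s.
by have /negP := acyc (Bseq (uniq_size_le us)); apply.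
Qed.

Lemma max_dipath_orderP r : 0 < #|T| ->
  (exists2 s, dipath r s & size s = max_dipath_order r) /\
  (forall s, dipath r s -> size s <= max_dipath_order r).
Proof.
move=> T_gt0; split=> [|s pth_s].
  have /card_gt0P[x _] := T_gt0.
  pose A := [pred s : {bseq #|T| of T} | dipath r s].
  have A_gt0 : 0 < #|A|.
    by apply/card_gt0P; exists (Bseq (T_gt0 : size [:: x] <= #|T|)).
  have [s ps eqs] := eq_bigmax_cond (fun s : {bseq #|T| of T} => size s) A_gt0.
  by exists s; rewrite // /max_dipath_order -eqs.
have /and3P[_ us _] := pth_s.
exact: (leq_bigmax_cond (Bseq (uniq_size_le us))
         (F := fun s : {bseq #|T| of T} => size s)).
Qed.

End Relations.

(* Mathcomp's [partition] requires the classes to be nonempty. *)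
Definition acyclic_dicolouring (D : digraph) (P : {set {set D}}) : bool :=
  [&& partition P [set: D],
      [forall A in P, acyclic (induced (@arc D) A)] &
      [forall A in P, forall B in P,
         (A != B) ==> acyclic (between (@arc D) A B)]].

Definition acyclic_dicolourable (D : digraph) (q : nat) : bool :=
  [exists P : {set {set D}}, acyclic_dicolouring P && (#|P| == q)].

(* Colouring every vertex with its own colour; between two singletons there is
   at most one arc since the digraph is oriented. *)
Lemma oriented_acyclic_dicolourable (D : digraph) :
  oriented D -> exists q, acyclic_dicolourable D q.
Proof.
move=> oD; pose P := [set [set x] | x : D]; exists #|P|.
apply/existsP; exists P; rewrite eqxx andbT; apply/and3P; split.
- apply/and3P; split.
  + apply/eqP/setP=> x; rewrite inE; apply/bigcupP.
    by exists [set x]; rewrite ?set11 // imset_f.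
  + apply/trivIsetP=> _ _ /imsetP[x _ ->] /imsetP[y _ ->] nxy.
    by rewrite disjoints1 inE; apply: contraNneq nxy => ->.
  + by apply/negP=> /imsetP[x _ /setP/(_ x)]; rewrite !inE eqxx.
- apply/forall_inP=> _ /imsetP[x _ ->]; apply/acyclicP.
  move=> [|a [|b s]] //; apply/negP=> /and3P[_ /= /andP[na _]].
  case/andP=> /and3P[/set1P ea /set1P eb _] _.
  by move: na; rewrite ea eb mem_head.
- apply/forall_inP=> _ /imsetP[x _ ->]; apply/forall_inP=> _ /imsetP[y _ ->].
  apply/implyP=> _; apply/acyclicP=> -[|a [|b [|c s]]] //; apply/negP=> /and3P[_].
    move=> _ /= /and3P[/andP[_ ab] /andP[_ ba] _].
    by move: (oD _ _ ab); rewrite ba.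
  rewrite /= !inE !negb_or => /andP[/and3P[nab nac _] _].
  case/and3P=> /andP[xy_ab _] /andP[xy_bc _] _; move: xy_ab xy_bc nab nac.
  rewrite !inE.
  by case/orP=> /andP[/eqP-> /eqP->] /orP[]/andP[/eqP yE /eqP->];
    rewrite ?eqxx // yE eqxx.
Qed.

Definition acyclic_dichromatic_number (D : digraph) (oD : oriented D) : nat :=
  ex_minn (oriented_acyclic_dicolourable oD).

Definition longest_dipath_order (D : digraph) : nat :=
  max_dipath_order (@arc D).

(* Main.v *)
Require Import Defs.
From mathcomp Require Import all_boot.

(** Colour the vertices by their depth in a depth-first search forest: a vertex
  of depth [k] ends a dipath of order [k + 1].  Let [R] be the set of vertices
  reached from the first root [x].  No arc leaves [R], so a dicycle lies in [R]
  or avoids it.  If it lies in [R] and meets only the levels [i] and [j], then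
  either [i] and [j] are positive and the dicycle is in the forest grown from
  the out-neighbours of [x] in [R] without [x]; or one of them is [0], all its
  arcs are incident with [x], and it would consist of two opposite arcs. *)

Section LevelColouring.

Set Implicit Arguments.
Unset Strict Implicit.
Unset Printing Implicit Defensive.

Variables (T : finType) (r : rel T).
Implicit Types (e : rel T) (S A R : {set T}) (c : T -> nat) (s : seq T).

(** The case [i = j] is allowed and gives the subdigraph induced by one class, so both conditions on
    a dicolouring are instances of one statement. *)
Definition levels S c (i j : nat) : rel T :=
  [rel x y | [&& x \in S, y \in S, r x y &
    (c x == i) && (c y == j) || (c x == j) && (c y == i)]].

Lemma sub_acyclic e e' : subrel e e' -> acyclic e' -> acyclic e.
Proof.
move=> ee' /acyclicP ac; apply/acyclicP=> s; apply: contraNN (ac s).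
by case/and3P=> s1 us cs; rewrite /dicycle s1 us (sub_cycle ee').
Qed.

(** Asymmetry excludes dicycles of order 2. In a longer one, two consecutive arcs share only their
    middle vertex, which must be [x]; the next arc then misses [x]. *)
Lemma acyclic_star e x :
    (forall u v, e u v -> ~~ e v u) ->
    (forall u v, e u v -> (u == x) || (v == x)) ->
  acyclic e.
Proof.
move=> asym star; apply/acyclicP=> -[|a [|b [|d s]]] //; apply/negP.
  by case/and3P=> _ _ /= /and3P[/asym/negPf->].
case/and3P=> _ /= /andP[+ /andP[+ _]]; rewrite !inE !negb_or.
move=> /and3P[nab nad nas] /andP[nbd nbs] /and3P[ab bd ds].
have bx : b = x.
  case/orP: (star _ _ ab) => /eqP // ax; case/orP: (star _ _ bd) => /eqP // dx.
  by rewrite ax dx eqxx in nad.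
(* The successor [y] of [d] is [a] if the dicycle has order 3, and the head of [s] otherwise. *)
have [y [dy nby]] : exists y, e d y /\ b != y.
  case: s ds nbs {nas} => [|y s] /= /andP[dy _].
    by exists a; rewrite eq_sym.
  by rewrite inE negb_or => /andP[]; exists y.
case/orP: (star _ _ dy) => /eqP zx; first by rewrite bx zx eqxx in nbd.
by rewrite bx zx eqxx in nby.
Qed.

(** Rotated to start at a vertex of [R], the cycle can never leave [R]. *)
Lemma cycle_closed e R s :
    (forall u v, u \in R -> e u v -> v \in R) -> cycle e s ->
  all [in R] s \/ all [in ~: R] s.
Proof.
move=> closedR cs; have [/hasP[x xs xR]|] := boolP (has [in R] s); last first.
  by rewrite -all_predC => /allP nR; right; apply/allP=> y /nR; rewrite /= inE.
left; have [k s' def_s] := rot_to xs; rewrite -(eq_all_r (mem_rot k s)) def_s.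
move: cs; rewrite -(rot_cycle k) def_s /= xR /= rcons_path => /andP[+ _].
elim: s' x xR {xs def_s} => //= y s' IH x xR /andP[/closedR yR].
by rewrite yR //; apply: IH; apply: yR.
Qed.

Lemma acyclic_closed e R :
    (forall u v, u \in R -> e u v -> v \in R) ->
    acyclic (induced e R) -> acyclic (induced e (~: R)) ->
  acyclic e.
Proof.
move=> closedR acR acC; apply/acyclicP=> s; apply/negP=> /and3P[s1 us cs].
have ind (X : {set T}) : all [in X] s -> dicycle (induced e X) s.
  move=> sX; rewrite /dicycle s1 us; apply: (sub_in_cycle _ sX cs) => u v uX vX.
  by move=> euv; apply/and3P.
case: (cycle_closed closedR cs) => /ind.
  by apply/negP; apply: (acyclicP _ acR).
by apply/negP; apply: (acyclicP _ acC).
Qed.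

Lemma connect_induced_last S R a y :
    (forall u v, u \in R -> induced r S u v -> v \in R) ->
    connect (induced r S) a y -> y \notin R ->
  (a \notin R) /\ connect (induced r (S :\: R)) a y.
Proof.
move=> closedR /connectP[p pth ->]; elim: p a pth => [|b p IH] a /=.
  by move=> _ aR; split.
case/andP=> ab pth /(IH _ pth)[bR cb].
have aR : a \notin R by apply: contraNN bR => /closedR; apply.
split=> //; apply: connect_trans cb; apply: connect1.
by case/and3P: ab => aS bS rab; apply/and3P; rewrite !in_setD aR bR.
Qed.

(** Take [z] to be the second vertex of a walk shortened to a path: the rest of the path avoids [x],
    and stays in [R] by closure. *)
Lemma connect_induced_first S R x y :
    (forall u v, u \in R -> induced r S u v -> v \in R) ->
    x \in R -> y != x -> connect (induced r S) x y ->
  exists z, [/\ r x z, z \in R :\ x & connect (induced r (R :\ x)) z y].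
Proof.
move=> closedR xR nyx /connectP[p /shortenP[p' pth up _] def_y].
case: p' pth up def_y => [_ _ /= yx|z p' /=]; first by rewrite yx eqxx in nyx.
case/andP=> xz pth /andP[nx _] def_y; rewrite inE negb_or in nx.
case/andP: nx => nxz nxp.
have zRx : z \in R :\ x by rewrite !inE eq_sym nxz (closedR x).
exists z; split=> //; first by case/and3P: xz.
apply/connectP; exists p' => //; elim: p' z zRx pth nxp {def_y nxz xz} => //=.
move=> b p' IH z zRx /andP[zb pth]; rewrite inE negb_or => /andP[nxb nxp].
have bRx : b \in R :\ x.
  by rewrite !inE eq_sym nxb (closedR z) //; case/setD1P: zRx.
by rewrite IH // andbT; apply/and3P; split=> //; case/and3P: zb.
Qed.

Hypothesis asym : forall x y, r x y -> ~~ r y x.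

(* [A] plays the role of the admissible roots: it makes the statement inductive,
   as a dipath from an out-neighbour of the first root can then be extended. *)
Lemma level_colouring S A :
    A \subset S ->
    (forall y, y \in S -> exists2 a, a \in A & connect (induced r S) a y) ->
  exists c : T -> nat,
    (forall y, y \in S -> exists x s,
       [/\ x \in A, all [in S] (x :: s), uniq (x :: s), path r x s
         & size s = c y]) /\
    (forall i j, acyclic (levels S c i j)).
Proof.
have [n] := ubnP #|S|; elim: n => // n IH in S A *; rewrite ltnS => leSn AS reach.
have [S0|[y0 /reach[x xA _]]] := set_0Vmem S.
  exists (fun=> 0); split=> [y|i j]; first by rewrite S0 inE.
  apply/acyclicP=> -[|a [|b s]] //; apply/negP=> /and3P[_ _ /andP[]].
  by case/and4P; rewrite S0 inE.
have xS : x \in S := subsetP AS x xA.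
pose R := [set y in S | connect (induced r S) x y].
have xR : x \in R by rewrite inE xS connect0.
have RS : R \subset S by apply/subsetP=> y; rewrite inE => /andP[].
have closedR u v : u \in R -> induced r S u v -> v \in R.
  rewrite !inE => /andP[_ xu] uv; case/and3P: (uv) => _ -> _ /=.
  exact: connect_trans xu (connect1 uv).
(* The subtrees hanging from [x]: their roots are restricted to out-neighbours of [x]. *)
have [|||c1 [path1 ac1]] := IH (R :\ x) [set z in R :\ x | r x z].
- rewrite (leq_trans _ leSn) // [#|S|](cardsD1 x) xS add1n ltnS.
  exact: subset_leq_card (setSD _ RS).
- by apply/subsetP=> z; rewrite inE => /andP[].
- move=> y /setD1P[nyx yR]; have := yR; rewrite inE => /andP[_ xy].
  have [z [rxz zR zy]] := connect_induced_first closedR xR nyx xy.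
  by exists z; rewrite // inE zR.
(* The remaining trees of the forest, whose depths start again at 0. *)
have [|||c2 [path2 ac2]] := IH (S :\: R) (A :\: R).
- rewrite (leq_trans _ leSn) //; apply: proper_card; apply/properP.
  by split; [apply: subsetDl | exists x; rewrite // inE xR].
- exact: setSD.
- move=> y /setDP[yS yR]; have [a aA ay] := reach y yS.
  have [aR cay] := connect_induced_last closedR ay yR.
  by exists a; rewrite // inE aR.
pose c y := if y \in R then if y == x then 0 else (c1 y).+1 else c2 y.
exists c; split=> [y yS|i j].
  rewrite /c; have [yR|yR] := boolP (y \in R); last first.
    have [|a [s [/setDP[aA _] /allP sS us ps sz]]] := path2 y; first exact/setDP.
    by exists a, s; split=> //; apply/allP=> w /sS; rewrite /= inE => /andP[].
  have [_|nyx] := eqVneq y x; first by exists x, [::]; rewrite /= xS.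
  have [|z [s [zA /allP sR us ps <-]]] := path1 y; first exact/setD1P.
  (* Prepending [x] raises the order by one, matching the successor in [c]; the old path lies in
     [R :\ x], so [x] is new. *)
  exists x, (z :: s); split=> //.
  - apply/allP=> w; rewrite in_cons => /predU1P[-> //|/sR].
    by case/setD1P=> _ /(subsetP RS).
  - by rewrite cons_uniq us andbT; apply/negP=> /sR /setD1P[]; rewrite eqxx.
  - by rewrite /= ps andbT; move: zA; rewrite inE => /andP[].
apply: (@acyclic_closed _ R) => [u v uR /and4P[uS vS ruv _]||].
- by apply: (closedR u) => //; apply/and3P.
- have [/andP[i0 j0]|ij0] := boolP ((0 < i) && (0 < j)).
    (* Positive levels exclude [x], and on the rest of [R] they are those of [c1] shifted by one. *)
    apply: sub_acyclic (ac1 i.-1 j.-1) => u v /and3P[uR vR] /and4P[_ _ ruv].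
    rewrite /c uR vR => cij; apply/and4P; move: cij; rewrite !in_setD1 uR vR.
    case: i i0 => // i _; case: j j0 => // j _.
    by case: (u == x); case: (v == x); rewrite ?andbF.
  apply: (@acyclic_star _ x) => u v /and3P[uR vR] /and4P[_ _ ruv].
    by move=> _; apply/negP=> /and3P[_ _ /and4P[_ _]]; rewrite (negPf (asym ruv)).
  rewrite /c uR vR; case: (u == x); case: (v == x) => //.
  by case: i ij0 => [|i]; case: j => [|j] //=; rewrite ?andbF.
- apply: sub_acyclic (ac2 i j) => u v /and3P[]; rewrite !in_setC => uR vR.
  case/and4P=> uS vS ruv; rewrite /c (negPf uR) (negPf vR) => cij.
  by apply/and4P; rewrite !in_setD uR vR.
Qed.

End LevelColouring.

Theorem theorem1p1 (D : digraph) (oD : oriented D) :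
  acyclic_dichromatic_number oD <= longest_dipath_order D.
Proof.
rewrite /acyclic_dichromatic_number; case: ex_minnP => m _ min_m.
have [||c [pathc acc]] := @level_colouring D (@Defs.arc D) oD setT setT => //.
  by move=> y _; exists y; rewrite ?inE // connect0.
(* The dipath [x :: s] has [c y + 1] vertices, hence the strict bound: the colours lie among the
   [longest_dipath_order D] values from 0. *)
have ltcL y : c y < longest_dipath_order D.
  have [//|x [s [_ _ us ps <-]]] := pathc y.
  by apply: (max_dipath_orderP (@Defs.arc D) (vertex_gt0 D)).2 (x :: s) _; apply/and3P.
pose P := preim_partition c [set: D].
have classE A : A \in P -> exists i, A = [set y | c y == i].
  by case/imsetP=> x _ ->; exists (c x); apply/setP=> y; rewrite !inE eq_sym.
(* Only an inequality holds in general, since [P] keeps just the nonempty fibres of [c]. *)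
have lePL : #|P| <= longest_dipath_order D.
  pose class (i : 'I_(longest_dipath_order D)) := [set y | c y == i].
  rewrite -[leqRHS]card_ord; apply: leq_trans (leq_imset_card class _).
  apply/subset_leq_card/subsetP=> A /imsetP[x _ ->].
  apply/imsetP; exists (Ordinal (ltcL x)) => //.
  by apply/setP=> y; rewrite !inE eq_sym.
apply: leq_trans lePL; apply: min_m; apply/existsP; exists P; rewrite eqxx andbT.
apply/and3P; split; first exact: preim_partitionP.
  apply/forall_inP=> A /classE[i ->]; apply: sub_acyclic (acc i i) => u v.
  by case/and3P; rewrite !inE => ci cj uv; apply/and4P; rewrite !inE ci cj.
apply/forall_inP=> A /classE[i ->]; apply/forall_inP=> B /classE[j ->].
apply/implyP=> _; apply: sub_acyclic (acc i j) => u v.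
by case/andP; rewrite !inE => cuv uv; apply/and4P; rewrite !inE cuv.
Qed.
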